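(* Let $\mathcal{H}$ be a real Hilbert space, let $A:\mathcal{H}\rightrightarrows\mathcal{H}$ be maximal monotone with $A^{-1}(0)\neq\emptyset$, let $\theta>0$, let $p\geq1$ be an integer, and let $x_0\in\Omega:=\{x\in\mathcal{H}:0\notin Ax\}$. Then the closed-loop control system \[ \dot{x}(t)+x(t)-(I+\lambda(t)A)^{-1}x(t)=0,\qquad \lambda(t)\,\|(I+\lambda(t)A)^{-1}x(t)-x(t)\|^{p-1}=\theta,\qquad x(0)=x_0, \] has a unique global solution $(x,\lambda):[0,+\infty)\to\mathcal{H}\times(0,+\infty)$, with $x(\cdot)$ continuously differentiable and $\lambda(\cdot)$ locally Lipschitz continuous. If $p\geq 2$, then \[ \|x(t)-(I+\lambda(t)A)^{-1}x(t)\|\geq \|x(0)-(I+\lambda(0)A)^{-1}x(0)\|\,e^{-t}\quad\text{for all } t\geq 0. \]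
   Context: $(I+\lambda A)^{-1}$ denotes the resolvent of the maximal monotone operator $A$ with index $\lambda>0$; $A^{-1}(0)=\{x\in\mathcal{H}:0\in Ax\}$. *)

(* Defs.v *)
From HB Require Import structures.
From mathcomp Require Import all_boot all_order all_algebra.
From mathcomp Require Import all_classical all_reals all_analysis.
Set Implicit Arguments. Unset Strict Implicit. Unset Printing Implicit Defensive.
Import Order.TTheory GRing.Theory Num.Theory.
Import numFieldNormedType.Exports.
Local Open Scope classical_set_scope.
Local Open Scope ring_scope.

Section Defs.
Context {R : realType} {V : normedModType R}.

(* ip is a real inner product inducing the norm of V; together with
   completeness of V this makes V a real Hilbert space. *)
Definition is_inner_product (ip : V -> V -> R) : Prop :=
  [/\ forall x y, ip x y = ip y x,
      forall x y z, ip (x + y) z = ip x z + ip y z,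
      forall (a : R) x y, ip (a *: x) y = a * ip x y
    & forall x, ip x x = `|x| ^+ 2].

Definition monotone (ip : V -> V -> R) (A : V -> set V) : Prop :=
  forall x y u v, A x u -> A y v -> 0 <= ip (x - y) (u - v).

Definition maximal_monotone (ip : V -> V -> R) (A : V -> set V) : Prop :=
  monotone ip A /\
  forall B : V -> set V, monotone ip B -> (forall x u, A x u -> B x u) -> B = A.

(* (I + lam A)^{-1} x : the (unique, for maximal monotone A and lam > 0)
   y with x ∈ y + lam A y. *)
Definition resolvent (A : V -> set V) (lam : R) (x : V) : V :=
  xget 0 [set y | exists u, A y u /\ x = y + lam *: u].

(* x' is the derivative of x on [0, +oo) (one-sided at 0). *)
Definition has_deriv_nonneg (x x' : R -> V) : Prop :=
  forall t, 0 <= t ->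
    (fun h : R => h^-1 *: (x (t + h) - x t))
      @ within [set h : R | h != 0 /\ 0 <= t + h] (nbhs (0 : R)) --> x' t.

Definition C1_nonneg (x : R -> V) : Prop :=
  exists x' : R -> V, has_deriv_nonneg x x' /\
    {within `[0, +oo[, continuous x'}.

Definition loc_lipschitz_nonneg (lam : R -> R) : Prop :=
  forall T, 0 <= T -> exists L : R, forall s t, 0 <= s <= T -> 0 <= t <= T ->
    `|lam s - lam t| <= L * `|s - t|.

Definition is_solution (A : V -> set V) (theta : R) (p : nat) (x0 : V)
    (x : R -> V) (lam : R -> R) : Prop :=
  [/\ x 0 = x0,
      forall t, 0 <= t -> 0 < lam t,
      forall t, 0 <= t ->
        lam t * `|resolvent A (lam t) (x t) - x t| ^+ (p - 1) = theta
    & exists x' : R -> V, [/\ has_deriv_nonneg x x',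
        {within `[0, +oo[, continuous x'} &
        forall t, 0 <= t -> x' t + x t - resolvent A (lam t) (x t) = 0]].

End Defs.

(* Main.v *)
(* Write [G x = x - (I + lam(x) A)^{-1} x], where [lam(x)] is the unique index
   with [lam(x) |G x|^(p-1) = theta] when [0] is not in [A x]; then [G x = 0]
   exactly on the zeros of [A]. Monotonicity of [l |-> |x - (I + l A)^{-1} x|]
   makes [|G|] 1-Lipschitz, and with the resolvent identity it makes [G] globally
   [p]-Lipschitz. The system is thus the Lipschitz equation [x' = - G x], solvable
   for all times, and since [|x'| = |G x|], the quantity [|G x|] decays at most
   like [e^{-t}]: trajectories never reach the zeros of [A], and
   [lam = theta / |G x|^(p-1)] stays locally Lipschitz. *)
Require Import Defs.
From HB Require Import structures.
From mathcomp Require Import all_boot all_order all_algebra.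
From mathcomp Require Import all_classical all_reals all_analysis.
From mathcomp Require Import ring lra.
Import Order.TTheory GRing.Theory Num.Theory.
Import numFieldNormedType.Exports.
Set Implicit Arguments.
Unset Strict Implicit.
Unset Printing Implicit Defensive.
Local Open Scope classical_set_scope.
Local Open Scope ring_scope.

(** For [p >= 2] the index blows up near the zeros of [A], so separate estimates of the index and of
    the residual would degenerate there and give only a local flow on [Omega]. A Lipschitz constant
    for [G] free of any lower bound on [|G|] removes the need for maximal solutions and
    continuation. It splits as [p = 1 + (p - 1)]: the residual at a fixed index costs [1], the
    change of index costs [p - 1]. Differential inequalities are stated with forward increments,
    since [|G x(t)|] and the distance of two solutions need not be differentiable. *)

(** * Geometric errors and limits *)

Lemma exp_half_lt (R : realType) (K e : R) : 0 < e ->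
  exists N : nat, K * 2^-1 ^+ N < e.
Proof.
move=> e0; have [K0|K0] := leP K 0.
  exists 0%N; rewrite expr0 mulr1; exact: le_lt_trans K0 e0.
have : (fun n => 2^-1 ^+ n : R) @ \oo --> (0 : R).
  by apply: cvg_expr; rewrite ger0_norm ?invr_ge0// invf_lt1// ltr1n.
move/cvgrPdist_lt => /(_ (e / K)); rewrite divr_gt0// => /(_ isT)[N _ /(_ N (leqnn N))] /=.
rewrite sub0r normrN ger0_norm ?exprn_ge0 ?invr_ge0//.
by move=> h; exists N; rewrite mulrC -ltr_pdivlMr.
Qed.

(** Approximations below carry errors [K * 2^-1 ^+ n], so this is how inequalities pass to the
    limit. *)
Lemma le_of_exp_half (R : realType) (a b K : R) :
  (forall n, a <= b + K * 2^-1 ^+ n) -> a <= b.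
Proof.
move=> h; apply/ler_addgt0Pr => e e0.
have [N hN] := exp_half_lt K e0.
by apply: le_trans (h N) _; rewrite lerD2l ltW.
Qed.

Lemma geometric_limit (R : realType) (V : completeNormedModType R)
    (u : nat -> V) (C : R) :
  (forall n, `|u n.+1 - u n| <= C * 2^-1 ^+ n) ->
  exists l, forall n, `|u n - l| <= 2 * C * 2^-1 ^+ n.
Proof.
move=> hu.
(* Subtracting the remaining tail makes the induction on [m] exact: that term drops by
   [C * 2^-1 ^+ (m + n)] at each step. *)
have tail n m : `|u (m + n)%N - u n| <= 2 * C * 2^-1 ^+ n - 2 * C * 2^-1 ^+ (m + n).
  elim: m => [|m IH]; first by rewrite !subrr normr0.
  rewrite (_ : _ - _ = (u (m + n).+1 - u (m + n)%N) + (u (m + n)%N - u n));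
    last by rewrite addrA subrK.
  apply: le_trans (ler_normD _ _) _; apply: le_trans (lerD (hu _) IH) _.
  by rewrite addSn exprS; lra.
have C0 : 0 <= C by have := hu 0%N; rewrite expr0 mulr1; apply: le_trans.
have tail' n m : (n <= m)%N -> `|u m - u n| <= 2 * C * 2^-1 ^+ n.
  move=> nm; have := tail n (m - n)%N; rewrite subnK// => /le_trans; apply.
  by rewrite gerBl mulr_ge0 ?exprn_ge0 ?mulr_ge0 ?invr_ge0.
have /cauchy_cvg /= cu : cauchy (u @ \oo).
  apply: cauchy_exP => e e0; have [N hN] := exp_half_lt (2 * C) e0.
  exists (u N); exists N => // m /= Nm.
  by rewrite -ball_normE /ball_ /= distrC; apply: le_lt_trans hN; apply: tail'.
exists (lim (u @ \oo)) => n; apply/ler_addgt0Pr => e e0.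
have /cvgr_dist_le/(_ _ e0)[N _ hN] := cu.
have /= h1 := hN (maxn N n) (leq_maxl _ _).
rewrite distrC (_ : _ - _ = (lim (u @ \oo) - u (maxn N n)) + (u (maxn N n) - u n));
  last by rewrite addrA subrK.
apply: le_trans (ler_normD _ _) _; rewrite addrC lerD//.
exact/tail'/leq_maxr.
Qed.

(** * Inner product calculus *)

Section Inner_product.
Context {R : realType} {V : normedModType R} (ip : V -> V -> R).
Hypothesis ipP : is_inner_product ip.
Implicit Types (x y z : V) (a : R).

Lemma ipC x y : ip x y = ip y x. Proof. by case: ipP. Qed.
Lemma ipDl x y z : ip (x + y) z = ip x z + ip y z. Proof. by case: ipP. Qed.
Lemma ipZl a x y : ip (a *: x) y = a * ip x y. Proof. by case: ipP. Qed.
Lemma ipxx x : ip x x = `|x| ^+ 2. Proof. by case: ipP. Qed.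
Lemma ipDr x y z : ip z (x + y) = ip z x + ip z y.
Proof. by rewrite ipC ipDl !(ipC z). Qed.
Lemma ipZr a x y : ip y (a *: x) = a * ip y x.
Proof. by rewrite ipC ipZl ipC. Qed.
Lemma ipNl x y : ip (- x) y = - ip x y.
Proof. by rewrite -scaleN1r ipZl mulN1r. Qed.
Lemma ipNr x y : ip y (- x) = - ip y x.
Proof. by rewrite ipC ipNl ipC. Qed.

Definition ipE := (ipDl, ipDr, ipNl, ipNr, ipZl, ipZr).

Lemma ip_normD x y : `|x + y| ^+ 2 = `|x| ^+ 2 + 2 * ip x y + `|y| ^+ 2.
Proof. by rewrite -!ipxx !ipE (ipC y x); ring. Qed.

Lemma ip_normB x y : `|x - y| ^+ 2 = `|x| ^+ 2 - 2 * ip x y + `|y| ^+ 2.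
Proof. by rewrite ip_normD normrN ipNr mulrN. Qed.

(** Cauchy-Schwarz, read off the squared triangle inequality of the norm. *)
Lemma ip_le x y : ip x y <= `|x| * `|y|.
Proof.
have h : `|x + y| ^+ 2 <= (`|x| + `|y|) ^+ 2.
  by rewrite ler_sqr ?nnegrE ?addr_ge0//; exact: ler_normD.
by rewrite ip_normD in h; nra.
Qed.

Lemma ip_abs_le x y : `|ip x y| <= `|x| * `|y|.
Proof.
rewrite ler_norml ip_le andbT lerNl -ipNl; apply: le_trans (ip_le _ _) _.
by rewrite normrN.
Qed.

End Inner_product.

(** * Minty's theorem and resolvents *)

(* Minimise [F(x, u) + (|x|^2 + |u|^2) / 2], where
   [F(x, u) = sup_(y, v in G) (<x, v> + <y, u> - <y, v>)] is the Fitzpatrick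
   function of [G]; since [F(x, u) >= <x, u>], with equality on [G], the
   variational inequality at the minimiser forces [u = - x] and [(x, u)] in
   [G]. [P x u q] says that the value at [(x, u)] is at most [q]. *)
Lemma minty (R : realType) (H : completeNormedModType R) (ip : H -> H -> R)
    (G : H -> H -> Prop) :
  is_inner_product ip ->
  (exists z w, G z w) ->
  (forall x y u v, G x u -> G y v -> 0 <= ip (x - y) (u - v)) ->
  (forall x u, (forall y v, G y v -> 0 <= ip (x - y) (u - v)) -> G x u) ->
  exists x, G x (- x).
Proof.
move=> ipP [z [w Gzw]] Gmono Gmax.
pose P x u (q : R) := forall y v, G y v ->
  ip x v + ip y u - ip y v + (`|x| ^+ 2 + `|u| ^+ 2) / 2 <= q.
have P_graph a b : G a b -> P a b (ip a b + (`|a| ^+ 2 + `|b| ^+ 2) / 2).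
  move=> Gab y v Gyv; have := Gmono _ _ _ _ Gab Gyv.
  by rewrite !(ipE ipP); lra.
(* Off the graph, maximality supplies a pair of [G] in strictly negative relation to [(x, u)], which
   pushes the supremum above [ip x u]. *)
have P_lower x u q : P x u q -> ip x u + (`|x| ^+ 2 + `|u| ^+ 2) / 2 <= q.
  move=> Pq; have [Gxu|nG] := pselect (G x u).
    by have := Pq _ _ Gxu; lra.
  have : exists y v, G y v /\ ip (x - y) (u - v) < 0.
    apply: contrapT => hn; apply: nG; apply: Gmax => y v Gyv.
    by rewrite leNgt; apply/negP => h; apply: hn; exists y, v.
  move=> [y [v [/Pq h1]]]; rewrite !(ipE ipP) => h2; lra.
have P_ge0 x u q : P x u q -> 0 <= q.
  move=> /P_lower; have := ip_normD ipP x u.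
  by have := sqr_ge0 `|x + u|; lra.
(* Strong convexity: a supremum of affine functions is convex, and the half squared norm contributes
   the quadratic gain. *)
have P_conv x u q x' u' q' (t : R) : 0 <= t <= 1 -> P x u q -> P x' u' q' ->
    P (x + t *: (x' - x)) (u + t *: (u' - u))
      ((1 - t) * q + t * q' - t * (1 - t) / 2 * (`|x - x'| ^+ 2 + `|u - u'| ^+ 2)).
  move=> /andP[t0 t1] h h' y v Gyv.
  have {}h := h y v Gyv; have {}h' := h' y v Gyv.
  have : (1 - t) * (ip x v + ip y u - ip y v + (`|x| ^+ 2 + `|u| ^+ 2) / 2) <= (1 - t) * q.
    by apply: ler_wpM2l => //; lra.
  have : t * (ip x' v + ip y u' - ip y v + (`|x'| ^+ 2 + `|u'| ^+ 2) / 2) <= t * q'.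
    exact: ler_wpM2l.
  rewrite !(ip_normB ipP) !(ip_normD ipP) -!(ipxx ipP) !(ipE ipP).
  rewrite (ipC ipP x' x) (ipC ipP u' u).
  move=> h1 h2; rewrite -subr_ge0.
  rewrite -subr_ge0 in h1; rewrite -subr_ge0 in h2.
  by apply: etrans (addr_ge0 h1 h2); congr (0 <= _); field.
pose E := [set q | exists x u, P x u q].
have E_lb : has_inf E.
  split; first by exists (ip z w + (`|z| ^+ 2 + `|w| ^+ 2) / 2), z, w; exact: P_graph.
  by exists 0 => q [x [u /P_ge0]].
pose m := inf E.
have mE q x u : P x u q -> m <= q.
  by move=> Pq; apply: ge_inf; [case: E_lb | exists x, u].
(* The error is a square because strong convexity turns gaps in value into squared distances: with
   [e = 2^-1 ^+ n], the midpoint gives [5 * e ^+ 2 <= (3 * e) ^+ 2]. *)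
have seqP n : exists xu : H * H, P xu.1 xu.2 (m + (2^-1 ^+ n) ^+ 2).
  have [|q [x [u Pq]] hq] := inf_adherent (_ : 0 < (2^-1 ^+ n : R) ^+ 2) E_lb.
    by rewrite exprn_gt0// exprn_gt0// invr_gt0.
  by exists (x, u) => y v /Pq /le_trans; apply; rewrite ltW.
have [f fP] := choice seqP.
have step n : `|(f n.+1).1 - (f n).1| ^+ 2 + `|(f n.+1).2 - (f n).2| ^+ 2
    <= (3 * 2^-1 ^+ n) ^+ 2.
  have t01 : 0 <= (2^-1 : R) <= 1 by rewrite invr_ge0 ler0n invf_le1 ?ler1n.
  have /mE := P_conv _ _ _ _ _ _ _ t01 (fP n.+1) (fP n).
  rewrite (exprS _ n); set e := 2^-1 ^+ n; have : 0 <= e ^+ 2 := sqr_ge0 e.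
  by rewrite !exprMn; lra.
have half0 n : 0 <= 2^-1 ^+ n :> R by rewrite exprn_ge0// invr_ge0.
have step1 n : `|(f n.+1).1 - (f n).1| <= 3 * 2^-1 ^+ n.
  rewrite -ler_sqr ?nnegrE ?mulr_ge0//; apply: le_trans (step n).
  by rewrite lerDl sqr_ge0.
have step2 n : `|(f n.+1).2 - (f n).2| <= 3 * 2^-1 ^+ n.
  rewrite -ler_sqr ?nnegrE ?mulr_ge0//; apply: le_trans (step n).
  by rewrite lerDr sqr_ge0.
have [x fx] := geometric_limit step1.
have [u fu] := geometric_limit step2.
(* Each constraint passes to the limit. The factor [6] is twice the [3] of the step bounds, and
   [+ 1] absorbs the gap in value by [e ^+ 2 <= e]. *)
have Pm : P x u m.
  move=> y v Gyv.
  apply: (@le_of_exp_half R _ _ (6 * (`|v| + `|x| + `|y| + `|u|) + 1)) => n.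
  have := fP n _ _ Gyv; set xn := (f n).1; set un := (f n).2.
  set e := 2^-1 ^+ n.
  have e0 : 0 <= e := half0 n.
  have e1 : e <= 1 by rewrite exprn_ile1 ?invr_ge0 ?invf_le1 ?ler1n.
  have hx : `|x - xn| <= 6 * e by rewrite distrC; have := fx n; rewrite -/e; lra.
  have hu : `|u - un| <= 6 * e by rewrite distrC; have := fu n; rewrite -/e; lra.
  have i1 : ip (x - xn) v <= `|v| * (6 * e).
    by apply: le_trans (ip_le ipP _ _) _; rewrite mulrC ler_wpM2l.
  have i2 : ip y (u - un) <= `|y| * (6 * e).
    by apply: le_trans (ip_le ipP _ _) _; rewrite ler_wpM2l.
  have i3 : ip x (x - xn) <= `|x| * (6 * e).
    by apply: le_trans (ip_le ipP _ _) _; rewrite ler_wpM2l.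
  have i4 : ip u (u - un) <= `|u| * (6 * e).
    by apply: le_trans (ip_le ipP _ _) _; rewrite ler_wpM2l.
  have i5 := sqr_ge0 `|x - xn|; have i6 := sqr_ge0 `|u - un|.
  have e2 : e ^+ 2 <= e by rewrite expr2 ler_piMr.
  move: i1 i2 i3 i4 i5 i6; rewrite !(ip_normB ipP) -!(ipxx ipP) !(ipE ipP).
  by lra.
(* First-order optimality: move from the minimiser towards [(a, b)] by [t], divide by [t] and let
   [t = 2^-1 ^+ n] vanish. *)
have opt a b : G a b ->
    m + (`|x - a| ^+ 2 + `|u - b| ^+ 2) / 2 <= ip a b + (`|a| ^+ 2 + `|b| ^+ 2) / 2.
  move=> Gab; set qa := ip a b + _; set D := `|x - a| ^+ 2 + _.
  apply: (@le_of_exp_half R _ _ (D / 2)) => n; set t := 2^-1 ^+ n.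
  have t0 : 0 < t by rewrite exprn_gt0// invr_gt0.
  have t1 : t <= 1 by rewrite exprn_ile1 ?invr_ge0 ?invf_le1 ?ler1n.
  have t01 : 0 <= t <= 1 by rewrite t1 ltW.
  have /mE := P_conv _ _ _ _ _ _ _ t01 Pm (P_graph _ _ Gab).
  rewrite -/D -/qa => h.
  have : t * (m + D / 2) <= t * (qa + D / 2 * t) by lra.
  by rewrite ler_pM2l.
(* Against any [(a, b)] in [G], [opt] and [P_lower] bound the pairing of the swapped point below by
   [|x + u|^2]. Once that point is in [G], taking it as [(a, b)] makes the pairing zero, hence
   [x = - u]. *)
have G' : G (- u) (- x).
  apply: Gmax => a b Gab; have := opt _ _ Gab; have := P_lower _ _ _ Pm.
  have := sqr_ge0 `|x + u|.
  rewrite !(ip_normB ipP) (ip_normD ipP) !(ipE ipP) (ipC ipP u x) (ipC ipP a x).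
  lra.
have : `|x + u| ^+ 2 <= 0.
  have := opt _ _ G'; have := P_lower _ _ _ Pm.
  rewrite !opprK !normrN (addrC u x) !(ip_normD ipP) !(ipE ipP) !opprK (ipC ipP u x).
  by lra.
rewrite exprn_even_le0//= normr_eq0 addr_eq0 => /eqP xu.
by exists x; rewrite {1}xu.
Qed.

Section Resolvent.
Context {R : realType} {H : completeNormedModType R} (ip : H -> H -> R).
Context (A : H -> set H).
Hypotheses (ipP : is_inner_product ip) (Amax : maximal_monotone ip A).
Hypothesis Azero : exists z, A z 0.
Implicit Types (x y : H) (l m : R).

(** Adjoining [(x, u)] to the graph keeps it monotone, so maximality has it there already. *)
Lemma maximal_monotone_mem x u :
  (forall y v, A y v -> 0 <= ip (x - y) (u - v)) -> A x u.
Proof.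
move=> xu; case: Amax => Amono Amaxi.
rewrite -(Amaxi (fun a b => A a b \/ a = x /\ b = u)).
- by right.
- move=> a b c d [Aac|[-> ->]] [Abd|[-> ->]].
  + exact: Amono.
  + by rewrite -(opprB x) -(opprB u) (ipNl ipP) (ipNr ipP) opprK; exact: xu.
  + exact: xu.
  + by rewrite !subrr (ipxx ipP) sqr_ge0.
- by move=> a b; left.
Qed.

Lemma resolventP l x : 0 < l ->
  A (resolvent A l x) (l^-1 *: (x - resolvent A l x)).
Proof.
move=> l0; have ln0 : l != 0 by rewrite gt_eqF.
case: (Amax) => Amono _.
(* The operator here is [l A - x]: a [y] with [- y] in [l A y - x] solves the resolvent inclusion,
   so [xget] never falls back on its default. *)
have [|||y Gy] := @minty _ _ _ (fun y w => A y (l^-1 *: (w + x))) ipP.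
- by have [z Az] := Azero; exists z, (- x); rewrite addNr scaler0.
- move=> a b c d Ga Gb; have := Amono _ _ _ _ Ga Gb.
  by rewrite -scalerBr opprD addrACA subrr addr0 (ipZr ipP) pmulr_rge0 ?invr_gt0.
- move=> a c h; apply: maximal_monotone_mem => b d Abd.
  have := h b (l *: d - x); rewrite subrK scalerA mulVf// scale1r => /(_ Abd).
  rewrite opprB addrA -{1}(scale1r (c + x)) -(divff ln0) -scalerA -scalerBr (ipZr ipP).
  by rewrite pmulr_rge0.
have : exists z, [set y | exists u, A y u /\ x = y + l *: u] z.
  exists y, (l^-1 *: (- y + x)); split => //.
  by rewrite scalerA divff// scale1r addrC addrAC addNr add0r.
move=> /(xgetPex 0) /= [u []]; rewrite -/(resolvent A l x) => Au xE.
by rewrite {2}xE addrAC subrr add0r scalerA mulVf// scale1r.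
Qed.

(** This is [l] times the Yosida approximation of [A]. *)
Definition residual l x := x - resolvent A l x.

Lemma residual_ip l m x y : 0 < l -> 0 < m ->
  0 <= ip ((x - residual l x) - (y - residual m y))
          (l^-1 *: residual l x - m^-1 *: residual m y).
Proof.
move=> l0 m0; rewrite /residual !subKr; case: (Amax) => Amono _.
by apply: Amono; exact: resolventP.
Qed.

(** Monotonicity at equal indices gives firm nonexpansiveness, [|b|^2 <= ip a b] for the increments
    [a] of the points and [b] of the residuals; Cauchy-Schwarz does the rest. *)
Lemma residual_nonexpansive l x y : 0 < l ->
  `|residual l x - residual l y| <= `|x - y|.
Proof.
move=> l0; have := residual_ip x y l0 l0.
rewrite -scalerBr (ipZr ipP) pmulr_rge0 ?invr_gt0//.
move: (residual l x) (residual l y) => r s.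
rewrite (_ : _ - _ = (x - y) - (r - s)); last by rewrite !opprB [LHS]addrACA [RHS]addrACA (addrC (- r)).
move: (x - y) (r - s) => a b; rewrite (ipDl ipP) (ipNl ipP) (ipxx ipP) subr_ge0 => h.
have := ip_le ipP a b; have [//|ab] := leP `|b| `|a|.
have := normr_ge0 a; nra.
Qed.

Lemma residual_ip_same l m x : 0 < l -> 0 < m ->
  0 <= ip (residual m x - residual l x) (m *: residual l x - l *: residual m x).
Proof.
move=> l0 m0; have := residual_ip x x l0 m0.
move: (residual l x) (residual m x) => r s.
rewrite (_ : x - r - _ = s - r); last by rewrite opprB addrC addrA subrK.
rewrite (_ : m *: r - l *: s = (l * m) *: (l^-1 *: r - m^-1 *: s)).
  by rewrite (ipZr ipP (l * m)) => h; rewrite mulr_ge0// mulr_ge0// ltW.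
by rewrite scalerBr !scalerA mulrAC divff ?gt_eqF// mul1r -mulrA divff ?gt_eqF// mulr1.
Qed.

(** A quantitative resolvent identity: writing [m r - l s = m (r - s) + (m - l) s] in the
    monotonicity inequality bounds [m |r - s|^2] by [|m - l| |r - s| |s|]. *)
Lemma residual_index l m x : 0 < l -> 0 < m ->
  m * `|residual l x - residual m x| <= `|m - l| * `|residual m x|.
Proof.
move=> l0 m0; have := residual_ip_same x l0 m0.
move: (residual l x) (residual m x) => r s.
rewrite (_ : m *: r - _ = m *: (r - s) + (m - l) *: s); last first.
  by rewrite scalerBr scalerBl addrA subrK.
rewrite -opprB (ipNl ipP) oppr_ge0 (ipDr ipP) !(ipZr ipP) (ipxx ipP).
move: (r - s) => d h.
have [->|d0] := eqVneq d 0; first by rewrite normr0 mulr0 mulr_ge0.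
rewrite -(@ler_pM2r _ `|d|) ?normr_gt0//.
have : - ((m - l) * ip d s) <= `|m - l| * (`|d| * `|s|).
  apply: le_trans (ler_norm _) _; rewrite normrN normrM ler_wpM2l//.
  exact: ip_abs_le.
by lra.
Qed.

Lemma residual_norm_le l m x : 0 < l -> l <= m ->
  `|residual l x| <= `|residual m x|.
Proof.
move=> l0 lm; have m0 : 0 < m by apply: lt_le_trans lm.
have := residual_ip_same x l0 m0.
move: (residual l x) (residual m x) => r s.
rewrite !(ipE ipP) !(ipxx ipP) (ipC ipP r s) => h; rewrite leNgt; apply/negP => sr.
have rs := ip_le ipP s r; have s0 := normr_ge0 s.
(* After Cauchy-Schwarz the monotonicity inequality factors; for [|s| < |r|] and [l <= m] the two
   factors have opposite signs. *)
have : 0 <= (m * `|r| - l * `|s|) * (`|s| - `|r|).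
  have : (m + l) * ip s r <= (m + l) * (`|s| * `|r|).
    by rewrite ler_wpM2l// addr_ge0// ltW.
  by lra.
have : 0 < m * `|r| - l * `|s| by nra.
by move=> h1; rewrite pmulr_rge0// subr_ge0 leNgt sr.
Qed.

Lemma residual_zero l x : 0 < l -> A x 0 -> residual l x = 0.
Proof.
move=> l0 Ax; case: (Amax) => Amono _.
have := Amono _ _ _ _ Ax (resolventP x l0).
rewrite sub0r (ipNr ipP) (ipZr ipP) (ipxx ipP) oppr_ge0 pmulr_rle0 ?invr_gt0//.
by rewrite exprn_even_le0//= normr_eq0 => /eqP.
Qed.

Lemma residual_eq0 l x : 0 < l -> residual l x = 0 -> A x 0.
Proof.
move=> l0 r0; have := resolventP x l0; rewrite -/(residual l x) r0 scaler0.
by move: r0 => /eqP; rewrite subr_eq0 => /eqP <-.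
Qed.

End Resolvent.

(** * The feedback index *)

Lemma bernoulli_le (R : realType) (r : R) n : 0 <= r -> r <= 1 ->
  1 - r ^+ n <= n%:R * (1 - r).
Proof.
move=> r0 r1; elim: n => [|n IH]; first by rewrite expr0 subrr mul0r.
have rn : r ^+ n <= 1 := exprn_ile1 n r0 r1.
rewrite exprS -natr1; have : (1 - r) * (1 - r ^+ n) >= 0 by rewrite mulr_ge0// subr_ge0.
have : 0 <= r ^+ n := exprn_ge0 n r0; lra.
Qed.

Section Feedback.
Context {R : realType} {H : completeNormedModType R} (ip : H -> H -> R).
Context (A : H -> set H) (theta : R) (n : nat).
Hypotheses (ipP : is_inner_product ip) (Amax : maximal_monotone ip A).
Hypothesis Azero : exists z, A z 0.
Hypothesis theta0 : 0 < theta.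
Implicit Types (x y : H) (l m : R).

Lemma residual_gt0 l x : 0 < l -> ~ A x 0 -> 0 < `|residual A l x|.
Proof.
by move=> l0 nA; rewrite normr_gt0; apply: contra_notN nA => /eqP;
  exact: (residual_eq0 ipP Amax Azero).
Qed.

Lemma residual_norm_continuous x m : 0 < m ->
  {for m, continuous (fun l => `|residual A l x|)}.
Proof.
move=> m0; apply/cvgrPdist_le => e e0.
set c := `|residual A m x| + 1.
have c0 : 0 < c by rewrite ltr_wpDl.
near=> l.
have l0 : 0 < l by near: l; exact: lt_nbhsr.
have ml : `|m - l| <= e * m / c.
  by near: l; apply: cvgr_dist_le; [exact: cvg_id | rewrite divr_gt0// mulr_gt0].
apply: le_trans (ler_dist_dist _ _) _; rewrite distrC -(ler_pM2l m0).
apply: le_trans (residual_index ipP Amax Azero x l0 m0) _.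
have : `|m - l| * c <= m * e by rewrite -ler_pdivlMr// [m * e]mulrC.
have : 0 <= `|m - l| by []. by rewrite /c; lra.
Unshelve. all: by end_near. Qed.

(** Strictness comes from the factor [l] alone, so the case [n = 0] is included. *)
Lemma index_lt x l m : ~ A x 0 -> 0 < l -> l < m ->
  l * `|residual A l x| ^+ n < m * `|residual A m x| ^+ n.
Proof.
move=> nA l0 lm; have r0 := residual_gt0 l0 nA.
apply: (@lt_le_trans _ _ (m * `|residual A l x| ^+ n)).
  by rewrite ltr_pM2r// exprn_gt0.
rewrite ler_pM2l; last exact: lt_trans lm.
apply: lerXn2r; rewrite ?nnegrE//.
by apply: (residual_norm_le ipP Amax Azero) => //; exact: ltW.
Qed.

Lemma index_exists x : ~ A x 0 ->
  exists l, 0 < l /\ l * `|residual A l x| ^+ n = theta.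
Proof.
move=> nA; pose f l := l * `|residual A l x| ^+ n.
pose c := `|residual A 1 x| ^+ n.
have c0 : 0 < c by rewrite exprn_gt0// residual_gt0.
(* Since [|residual|] is nondecreasing in the index, [f l <= l * c] for [l <= 1] and [f l >= l * c]
   for [l >= 1]; these endpoints therefore bracket [theta]. *)
pose a := Num.min 1 (theta / c); pose b := Num.max 1 (theta / c).
have a0 : 0 < a by rewrite lt_min ltr01 divr_gt0.
have ab : a <= b by rewrite le_max ge_min lexx.
have fa : f a <= theta.
  apply: (@le_trans _ _ (a * c)); last first.
    by rewrite -ler_pdivlMr// ge_min lexx orbT.
  rewrite /f ler_pM2l//; apply: lerXn2r; rewrite ?nnegrE//.
  by apply: (residual_norm_le ipP Amax Azero) => //; rewrite ge_min lexx.
have b1 : 1 <= b by rewrite le_max lexx.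
have b0 : 0 < b by exact: lt_le_trans b1.
have fb : theta <= f b.
  apply: (@le_trans _ _ (b * c)).
    by rewrite -ler_pdivrMr// le_max lexx orbT.
  rewrite /f ler_pM2l//; apply: lerXn2r; rewrite ?nnegrE//.
  exact: (residual_norm_le ipP Amax Azero).
have cf : {within `[a, b], continuous f}.
  apply: continuous_in_subspaceT => l; rewrite inE /= in_itv /= => /andP[al _].
  have l0 : 0 < l by exact: lt_le_trans al.
  apply: cvgM; first exact: cvg_id.
  apply: (@continuous_comp _ _ _ (fun l => `|residual A l x|) (fun r => r ^+ n)).
    exact: residual_norm_continuous.
  exact: exprn_continuous.
have [|l] := IVT ab cf (v := theta).
  by rewrite ge_min fa le_max fb orbT.
rewrite in_itv /= => /andP[al _] fl; exists l; split => //.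
exact: lt_le_trans al.
Qed.

(** The default [1] keeps the index positive at the zeros of [A], where for [n > 0] the equation has
    no solution. The residual vanishes there at every positive index. *)
Definition feedback_index x : R :=
  xget 1 [set l | 0 < l /\ l * `|residual A l x| ^+ n = theta].

Lemma feedback_index_gt0 x : 0 < feedback_index x.
Proof. by rewrite /feedback_index; case: xgetP => // l _ []. Qed.

Lemma feedback_indexE x : ~ A x 0 ->
  feedback_index x * `|residual A (feedback_index x) x| ^+ n = theta.
Proof. by move=> /index_exists /(xgetPex 1) /= []. Qed.

Lemma feedback_index_unique x l : ~ A x 0 -> 0 < l ->
  l * `|residual A l x| ^+ n = theta -> l = feedback_index x.
Proof.
move=> nA l0 lE; have m0 := feedback_index_gt0 x; have mE := feedback_indexE nA.
have [lm|ml|//] := ltgtP l (feedback_index x).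
  by have := index_lt nA l0 lm; rewrite lE mE ltxx.
by have := index_lt nA m0 ml; rewrite lE mE ltxx.
Qed.

Definition feedback_residual x := residual A (feedback_index x) x.

Local Notation lam := feedback_index.
Local Notation G := feedback_residual.

Lemma feedback_residual0 x : A x 0 -> G x = 0.
Proof. exact: (residual_zero ipP Amax Azero (feedback_index_gt0 x)). Qed.

Lemma feedback_residual_gt0 x : ~ A x 0 -> 0 < `|G x|.
Proof. by apply: residual_gt0; exact: feedback_index_gt0. Qed.

Lemma feedback_residual_memN x : 0 < `|G x| -> ~ A x 0.
Proof. by move=> gx Ax; move: gx; rewrite (feedback_residual0 Ax) normr0 ltxx. Qed.

Lemma feedback_index_eq x : ~ A x 0 -> lam x = theta / `|G x| ^+ n.
Proof.
move=> nA; rewrite -(feedback_indexE nA) mulfK// expf_neq0//.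
by rewrite gt_eqF// feedback_residual_gt0.
Qed.

Lemma feedback_index_le x y : ~ A x 0 -> ~ A y 0 -> `|G x| <= `|G y| ->
  lam y <= lam x.
Proof.
move=> nx ny xy; rewrite !feedback_index_eq// ler_pM2l//.
by rewrite lef_pV2 ?posrE ?exprn_gt0 ?feedback_residual_gt0// lerXn2r ?nnegrE.
Qed.

(** If [|G x| < |G y|], then [lam y <= lam x]. Comparing both points at the smaller index [lam y]
    and then raising it to [lam x] at the point [x] only increases the bound. *)
Lemma feedback_residual_norm_lip x y : `|G y| <= `|G x| + `|x - y|.
Proof.
have ns l : 0 < l -> `|residual A l y| <= `|residual A l x| + `|x - y|.
  move=> l0; rewrite -{1}(subrK (residual A l x) (residual A l y)) addrC.
  apply: le_trans (ler_normD _ _) _; rewrite lerD2l (distrC x y).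
  exact: (residual_nonexpansive ipP Amax Azero).
have [/feedback_residual0 ->|ny] := pselect (A y 0).
  by rewrite normr0 addr_ge0.
have ly := feedback_index_gt0 y.
have [Ax|nx] := pselect (A x 0).
  rewrite (feedback_residual0 Ax) -(residual_zero ipP Amax Azero ly Ax).
  exact: ns.
have [yx|/ltW xy] := leP `|G y| `|G x|; first by rewrite ler_wpDr.
apply: le_trans (ns _ ly) _; rewrite lerD2r.
apply: (residual_norm_le ipP Amax Azero) => //.
exact: feedback_index_le.
Qed.

(* On [0 < |G y| <= |G x|] the ratio of the indices is [(|G y| / |G x|)^n], and
   Bernoulli's inequality turns the dependence of the resolvent on its index
   into [n |x - y|]; no lower bound on the residuals is needed. *)
Lemma feedback_residual_lip x y : `|G x - G y| <= n.+1%:R * `|x - y|.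
Proof.
wlog yx : x y / `|G y| <= `|G x| => [hw|].
  have [|/ltW] := leP `|G y| `|G x|; first exact: hw.
  by move=> xy; rewrite (distrC (G x) (G y)) (distrC x y); exact: hw.
have n1 : `|x - y| <= n.+1%:R * `|x - y| by rewrite ler_peMl// ler1n.
have [Ay|ny] := pselect (A y 0).
  rewrite (feedback_residual0 Ay) subr0; apply: le_trans n1.
  have := feedback_residual_norm_lip y x.
  by rewrite (feedback_residual0 Ay) normr0 add0r (distrC y x).
have gy := feedback_residual_gt0 ny; have gx := lt_le_trans gy yx.
have nx := feedback_residual_memN gx.
have lx := feedback_index_gt0 x; have ly := feedback_index_gt0 y.
(* The intermediate point changes [x] to [y] at fixed index, at cost [|x - y|], and then changes the
   index at [y]. *)
rewrite -(subrK (residual A (lam x) y) (G x)) -addrA.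
apply: le_trans (ler_normD _ _) _; rewrite -natr1 mulrDl mul1r (addrC (n%:R * _)) lerD//.
  exact: (residual_nonexpansive ipP Amax Azero).
have lxy := feedback_index_le ny nx yx.
have := residual_index ipP Amax Azero y lx ly.
rewrite ger0_norm ?subr_ge0// -[residual A (lam y) y]/(G y) => h.
have {}h : `|residual A (lam x) y - G y| <= (1 - lam x / lam y) * `|G y|.
  by rewrite -(ler_pM2l ly) mulrA mulrBr mulr1 [lam y * (_ / _)]mulrC divfK ?gt_eqF.
apply: le_trans h _.
set r := `|G y| / `|G x|.
have r0 : 0 <= r by rewrite divr_ge0.
have r1 : r <= 1 by rewrite ler_pdivrMr// mul1r.
have -> : lam x / lam y = r ^+ n.
  rewrite !feedback_index_eq// expr_div_n.
  have : `|G y| ^+ n != 0 by rewrite expf_neq0// gt_eqF.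
  have : `|G x| ^+ n != 0 by rewrite expf_neq0// gt_eqF.
  have : theta != 0 by rewrite gt_eqF.
  by move: (_ ^+ n) (`|G x| ^+ n) => a b ? ? ?; field; do ?[apply/andP; split].
apply: (@le_trans _ _ (n%:R * ((1 - r) * `|G y|))).
  by rewrite mulrA ler_wpM2r//; exact: bernoulli_le.
rewrite ler_wpM2l//.
(* Here the small denominators cancel: what is left is a difference of norms, controlled by
   [feedback_residual_norm_lip]. *)
have -> : (1 - r) * `|G y| = r * (`|G x| - `|G y|).
  by rewrite mulrBr /r divfK ?gt_eqF// mulrBl mul1r.
apply: (@le_trans _ _ (1 * (`|G x| - `|G y|))).
  by rewrite ler_wpM2r// subr_ge0.
by rewrite mul1r lerBlDl (distrC x y); exact: feedback_residual_norm_lip.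
Qed.

End Feedback.

(** * Lipschitz differential equations *)

Section Euler.
Context {R : realType} {V : completeNormedModType R} (F : V -> V) (L : R).
Hypotheses (L0 : 0 <= L) (F_lip : forall x y, `|F x - F y| <= L * `|x - y|).
Variable x0 : V.
Implicit Types (h s t T : R) (i j k m : nat).

Definition euler h j : V := iter j (fun a => a + h *: F a) x0.

Lemma eulerS h j : euler h j.+1 = euler h j + h *: F (euler h j).
Proof. by []. Qed.

(** Bounds [|F|] along every polygon up to time [T]: a step multiplies it by at most
    [1 + L * h <= expR (L * h)]. *)
Definition euler_speed T : R := expR (L * T) * `|F x0|.

Lemma euler_speed_ge0 T : 0 <= euler_speed T.
Proof. by rewrite mulr_ge0// expR_ge0. Qed.

Lemma euler_growth h j T : 0 <= h -> j%:R * h <= T ->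
  (1 + L * h) ^+ j <= expR (L * T).
Proof.
move=> h0 jT; have Lh : 0 <= L * h by rewrite mulr_ge0.
apply: (@le_trans _ _ (expR (L * h) ^+ j)).
  apply: lerXn2r; rewrite ?nnegrE ?expR_ge0 ?addr_ge0//.
  exact: expR_ge1Dx.
by rewrite -expRM_natl ler_expR mulrCA ler_wpM2l.
Qed.

Lemma euler_speed_le h j T : 0 <= h -> j%:R * h <= T ->
  `|F (euler h j)| <= euler_speed T.
Proof.
move=> h0 jT; apply: (@le_trans _ _ ((1 + L * h) ^+ j * `|F x0|)); last first.
  by rewrite ler_wpM2r//; exact: euler_growth.
elim: j {jT} => [|j IH]; first by rewrite expr0 mul1r.
rewrite eulerS -(subrK (F (euler h j)) (F _)).
apply: le_trans (ler_normD _ _) _.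
apply: (@le_trans _ _ ((1 + L * h) * `|F (euler h j)|)).
  rewrite mulrDl mul1r addrC lerD2l; apply: le_trans (F_lip _ _) _.
  by rewrite addrC addKr normrZ ger0_norm// mulrA.
by rewrite exprS -mulrA ler_wpM2l// addr_ge0// mulr_ge0.
Qed.

Lemma euler_dist h j m T : 0 <= h -> (j + m)%:R * h <= T ->
  `|euler h (j + m) - euler h j| <= m%:R * h * euler_speed T.
Proof.
move=> h0; elim: m => [|m IH] mT; first by rewrite addn0 subrr normr0 !mul0r.
have mT' : (j + m)%:R * h <= T.
  by apply: le_trans mT; rewrite ler_wpM2r// ler_nat addnS.
rewrite addnS eulerS addrAC; apply: le_trans (ler_normD _ _) _.
rewrite -natr1 !mulrDl mul1r lerD ?IH//.
by rewrite normrZ ger0_norm// ler_wpM2l//; exact: euler_speed_le.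
Qed.

(** The constant does not depend on the mesh, so the estimate survives the limit and there yields
    the derivative. *)
Lemma euler_taylor h j m T : 0 <= h -> (j + m)%:R * h <= T ->
  `|euler h (j + m) - euler h j - (m%:R * h) *: F (euler h j)|
    <= L * euler_speed T * (m%:R * h) ^+ 2.
Proof.
move=> h0; elim: m => [|m IH] mT.
  by rewrite addn0 subrr mul0r scale0r subr0 normr0 expr0n/= mulr0.
have mT' : (j + m)%:R * h <= T.
  by apply: le_trans mT; rewrite ler_wpM2r// ler_nat addnS.
have {}IH := IH mT'; have d := euler_dist h0 mT'.
rewrite addnS eulerS -natr1; set a := euler h (j + m); set b := euler h j.
rewrite -/a -/b in IH d.
rewrite (_ : _ - _ = (a - b - (m%:R * h) *: F b) + h *: (F a - F b)); last first.
  rewrite mulrDl mul1r scalerDl scalerBr opprD !addrA.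
  by rewrite [a + _ - b]addrAC -!addrA; congr (a + (- b + _)); rewrite addrCA.
apply: le_trans (ler_normD _ _) _; apply: le_trans (lerD IH (lexx _)) _.
rewrite normrZ ger0_norm//.
have h1 : h * `|F a - F b| <= h * (L * (m%:R * h * euler_speed T)).
  rewrite ler_wpM2l//; apply: le_trans (F_lip _ _) _; exact: ler_wpM2l.
apply: le_trans (lerD (lexx _) h1) _.
have h2 : 0 <= L * euler_speed T * (m%:R + 1) * h ^+ 2.
  by rewrite !mulr_ge0 ?euler_speed_ge0 ?exprn_ge0 ?addr_ge0.
by lra.
Qed.

(** Two half steps differ from one full step by at most [L * M * h ^+ 2], by [euler_taylor] with
    [m = 2], and earlier errors grow by [1 + L * h] per step. *)
Lemma euler_refine h j T : 0 <= h -> j%:R * h <= T ->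
  `|euler (h / 2) (j * 2) - euler h j|
    <= expR (L * T) * T * L * euler_speed T * h.
Proof.
move=> h0 jT; have h20 : 0 <= h / 2 by rewrite divr_ge0.
have T0 : 0 <= T by apply: le_trans jT; rewrite mulr_ge0.
set M := euler_speed T; have M0 : 0 <= M := euler_speed_ge0 T.
have Lh : 0 <= L * h by rewrite mulr_ge0.
have Lh1 : 1 <= 1 + L * h by rewrite lerDl.
apply: (@le_trans _ _ ((1 + L * h) ^+ j * (j%:R * (L * M * h ^+ 2)))); last first.
  have := ler_pM (exprn_ge0 j (le_trans ler01 Lh1)) (mulr_ge0 (ler0n _ j) h0)
    (euler_growth h0 jT) jT.
  move=> /(ler_wpM2r (mulr_ge0 (mulr_ge0 L0 M0) h0)); lra.
elim: j jT => [|j IH] jT; first by rewrite subrr normr0 !mul0r mulr0.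
have jT' : j%:R * h <= T.
  by apply: le_trans jT; rewrite ler_wpM2r// ler_nat.
have {}IH := IH jT'.
have := @euler_taylor (h / 2) (j * 2) 2 T h20.
have -> : (j * 2 + 2)%:R * (h / 2) = j.+1%:R * h.
  by rewrite natrD natrM -natr1; field.
move=> /(_ jT); have -> : 2%:R * (h / 2) = h by field.
rewrite -/M mulSn [(2 + _)%N]addnC eulerS.
set b := euler (h / 2) (j * 2) in IH *; set a := euler h j in IH *.
set c := euler _ _ => ctay.
rewrite (_ : c - _ = (c - b - h *: F b) + ((b - a) + h *: (F b - F a))); last first.
  by rewrite scalerBr [X in _ = _ + X]addrACA -[c - b - _]addrA -!opprD addrA subrK.
apply: le_trans (ler_normD _ _) _.
apply: le_trans (lerD ctay (ler_normD _ _)) _.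
rewrite normrZ ger0_norm//.
have h1 : h * `|F b - F a| <= h * (L * `|b - a|) by rewrite ler_wpM2l.
have h2 : (1 + L * h) * `|b - a|
   <= (1 + L * h) * ((1 + L * h) ^+ j * (j%:R * (L * M * h ^+ 2))).
  by rewrite ler_wpM2l// addr_ge0.
have h3 : 1 * (L * M * h ^+ 2) <= (1 + L * h) ^+ j.+1 * (L * M * h ^+ 2).
  by rewrite ler_wpM2r ?exprn_ege1// !mulr_ge0.
rewrite (exprS _ j) in h3 *; rewrite -natr1; lra.
Qed.

Definition mesh k : R := 2^-1 ^+ k.
Definition node k t : nat := Num.truncn (t / mesh k).
(** A step function, frozen at the last node up to [t]; interpolation would change it only by the
    order of the mesh. *)
Definition polygon k t : V := euler (mesh k) (node k t).

Lemma mesh_gt0 k : 0 < mesh k.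
Proof. by rewrite exprn_gt0// invr_gt0. Qed.

Lemma mesh_le1 k : mesh k <= 1.
Proof. by rewrite exprn_ile1// ?invr_ge0// invf_le1// ler1n. Qed.

Lemma meshS k : mesh k.+1 = mesh k / 2.
Proof. by rewrite /mesh exprS mulrC. Qed.

Lemma node_le k t : 0 <= t -> (node k t)%:R * mesh k <= t.
Proof.
by move=> t0; rewrite -ler_pdivlMr ?mesh_gt0// truncn_le divr_ge0// ltW// mesh_gt0.
Qed.

Lemma node_gt k t : t < (node k t).+1%:R * mesh k.
Proof. by rewrite -ltr_pdivrMr ?mesh_gt0// truncnS_gt. Qed.

Lemma node_mono k s t : s <= t -> (node k s <= node k t)%N.
Proof. by move=> st; apply: le_truncn; rewrite ler_pM2r// invr_gt0 mesh_gt0. Qed.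

(** Halving keeps all coarse nodes, so the last fine node is the last coarse one or the midpoint
    after it. *)
Lemma nodeS k t : 0 <= t -> exists2 b : nat, (b <= 1)%N & node k.+1 t = (node k t * 2 + b)%N.
Proof.
move=> t0; have [h0 h1] := (node_le k t0, node_gt k t).
have [g0 g1] := (node_le k.+1 t0, node_gt k.+1 t).
have m0 := mesh_gt0 k.
have lo : (node k t * 2 <= node k.+1 t)%N.
  rewrite -ltnS -(@ltr_nat R) -(@ltr_pM2r _ (mesh k.+1)) ?mesh_gt0//.
  by apply: le_lt_trans g1; rewrite natrM meshS mulrA -mulrA mulrCA mulrAC; lra.
have up : (node k.+1 t < node k t * 2 + 2)%N.
  rewrite -(@ltr_nat R) -(@ltr_pM2r _ (mesh k.+1)) ?mesh_gt0//.
  by apply: le_lt_trans g0 _; rewrite natrD natrM meshS; rewrite -natr1 in h1; lra.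
exists (node k.+1 t - node k t * 2)%N; last by rewrite subnKC.
by rewrite leq_subLR -ltnS addn1 -addn2.
Qed.

(** The first term pays for the possible extra half step of [nodeS], the second for
    [euler_refine]. *)
Definition polygon_const T : R :=
  euler_speed T + expR (L * T) * T * L * euler_speed T.

Lemma polygonS k t : 0 <= t ->
  `|polygon k.+1 t - polygon k t| <= polygon_const t * 2^-1 ^+ k.
Proof.
move=> t0; have [b b1 E] := nodeS k t0.
rewrite /polygon /polygon_const -/(mesh k).
have g := node_le k.+1 t0; rewrite E in g *.
rewrite -(subrK (euler (mesh k.+1) (node k t * 2)) (euler _ (_ + b))) -addrA.
apply: le_trans (ler_normD _ _) _; rewrite mulrDl lerD//.
  apply: le_trans (euler_dist (ltW (mesh_gt0 _)) g) _.
  rewrite mulrC ler_wpM2l ?euler_speed_ge0// meshS.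
  have : b%:R <= 1%:R :> R by rewrite ler_nat.
  by have := mesh_gt0 k; nra.
by rewrite meshS; apply: euler_refine; [exact/ltW/mesh_gt0 | exact: node_le].
Qed.

End Euler.

Section Lipschitz_ode.
Context {R : realType} {V : completeNormedModType R} (F : V -> V) (L : R).
Hypotheses (L0 : 0 <= L) (F_lip : forall x y, `|F x - F y| <= L * `|x - y|).
Variable x0 : V.

Local Notation M := (euler_speed F L x0).

(* Euler's polygons on the dyadic grids converge at rate [2^-k], uniformly on
   bounded intervals, and the discrete Taylor estimate passes to the limit. *)
Lemma lipschitz_ode : exists x : R -> V, x 0 = x0 /\
  forall T, 0 <= T -> exists2 C, 0 <= C &
    forall s t, 0 <= s <= T -> 0 <= t <= T ->
      `|x t - x s - (t - s) *: F (x s)| <= C * (t - s) ^+ 2 /\ `|F (x s)| <= C.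
Proof.
pose K t := 2 * polygon_const F L x0 t.
(* The sign condition sits under the quantifier so that [choice] gives a function on all of [R],
   arbitrary at negative times. *)
have limP (t : R) : exists l, 0 <= t ->
    forall k, `|polygon F x0 k t - l| <= K t * mesh k.
  have [t0|t0] := leP 0 t; last by exists 0.
  have [l hl] := geometric_limit (fun k => polygonS L0 F_lip x0 k t0).
  by exists l.
have [x xP] := choice limP; exists x; split.
  apply/esym/eqP; rewrite -subr_eq0 -normr_le0.
  apply: (@le_of_exp_half _ _ _ (K 0)) => k; rewrite add0r.
  have := xP 0 (lexx _) k; congr (`|_ - _| <= _).
  by rewrite /polygon /node mul0r truncn0.
move=> T T0; pose MT := M T.
have MT0 : 0 <= MT := euler_speed_ge0 F L x0 T.
have speed t : 0 <= t <= T -> `|F (x t)| <= MT.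
  move=> /andP[t0 tT]; apply: (@le_of_exp_half _ _ _ (L * K t)) => k.
  rewrite -(subrK (F (polygon F x0 k t)) (F (x t))) addrC.
  apply: le_trans (ler_normD _ _) _; apply: lerD.
    apply: (euler_speed_le L0 F_lip); first exact/ltW/mesh_gt0.
    by apply: le_trans tT; exact: node_le.
  apply: le_trans (F_lip _ _) _; rewrite -mulrA ler_wpM2l// distrC.
  exact: xP.
have taylor s t : 0 <= s -> s <= t -> t <= T ->
    `|x t - x s - (t - s) *: F (x s)| <= L * MT * (t - s) ^+ 2.
  move=> s0 st tT; have t0 := le_trans s0 st.
  pose D := t - s; have D0 : 0 <= D by rewrite subr_ge0.
  apply: (@le_of_exp_half _ _ _
    (L * MT * (2 * D + 1) + K t + K s + MT + D * (L * K s))) => k.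
  rewrite -/D -/(mesh k); set h := mesh k.
  have h0 : 0 < h := mesh_gt0 k; have h1 : h <= 1 := mesh_le1 k.
  have ns := node_mono k st; set i := node k s in ns *.
  pose m := (node k t - i)%N.
  have im : node k t = (i + m)%N by rewrite subnKC.
  have it : (i + m)%:R * h <= t by rewrite -im; exact: node_le.
  have it' : t < ((i + m)%:R + 1) * h by rewrite natr1 -im; exact: node_gt.
  have is0 : i%:R * h <= s by exact: node_le.
  have is1 : s < (i%:R + 1) * h by rewrite natr1; exact: node_gt.
  have tay := euler_taylor L0 F_lip x0 (ltW h0) (le_trans it tT).
  have xt := xP t t0 k; have xs := xP s s0 k.
  rewrite /polygon im -/h -/i in xt; rewrite /polygon -/h -/i in xs.
  have Fs := euler_speed_le L0 F_lip x0 (ltW h0) (le_trans is0 (le_trans st tT)).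
  rewrite -/MT in tay Fs.
  set a := euler F x0 h (i + m) in tay xt *; set b := euler F x0 h i in tay xs Fs *.
  rewrite natrD in it it'.
  have mD1 : m%:R * h <= D + h by rewrite /D; lra.
  have mD2 : D - h <= m%:R * h by rewrite /D; lra.
  rewrite (_ : x t - x s - _ = (a - b - (m%:R * h) *: F b) + (x t - a) + (b - x s)
     + (m%:R * h - D) *: F b + D *: (F b - F (x s))); last first.
    rewrite (scalerBl _ D) scalerBr.
    move: (D *: F (x s)) (D *: F b) (_ *: F b) => q p r; move: (x t) (x s) => y z.
    rewrite -[RHS]addrA [r - p + _]addrA subrK -(addrA a) -opprD.
    rewrite (addrC (a - _)) [y - a + _]addrA subrK (addrC b r) opprD [y + (_ - b)]addrA.
    by rewrite [y - r - b + _]addrA subrK [y - r - z]addrAC [RHS]addrA subrK.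
  apply: le_trans (ler_normD _ _) _.
  apply: le_trans (lerD (ler_normD _ _) (lexx _)) _.
  apply: le_trans (lerD (lerD (ler_normD _ _) (lexx _)) (lexx _)) _.
  apply: le_trans (lerD (lerD (lerD (ler_normD _ _) (lexx _)) (lexx _)) (lexx _)) _.
  rewrite distrC in xt.
  have e4 : `|(m%:R * h - D) *: F b| <= h * MT.
    rewrite normrZ ler_pM// ler_norml; apply/andP; split; lra.
  have e5 : `|D *: (F b - F (x s))| <= D * (L * (K s * h)).
    rewrite normrZ ger0_norm// ler_wpM2l//; apply: le_trans (F_lip _ _) _.
    exact: ler_wpM2l.
  have e1 : L * MT * (m%:R * h) ^+ 2 <= L * MT * (D ^+ 2 + (2 * D + 1) * h).
    rewrite ler_wpM2l ?mulr_ge0//.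
    apply: (@le_trans _ _ ((D + h) ^+ 2)).
      have h00 := ltW h0.
      have mh0 : 0 <= m%:R * h by exact: mulr_ge0.
      apply: lerXn2r => //; first exact: addr_ge0.
    have : h ^+ 2 <= h by rewrite expr2 ler_piMr// ltW.
    by rewrite sqrrD; lra.
  lra.
(* The first term serves [s <= t]. For [t < s] the expansion at [t] is moved to base [s], at the
   cost of the second. The last covers [|F (x s)|]. *)
pose C := L * MT + L * (MT + L * MT * T) + MT.
have LM0 : 0 <= L * MT by rewrite mulr_ge0.
have LMT0 : 0 <= L * (MT + L * MT * T).
  by rewrite mulr_ge0// addr_ge0// mulr_ge0.
have CE : L * MT + L * (MT + L * MT * T) <= C by rewrite lerDl.
exists C; first by rewrite /C !addr_ge0.
move=> s t sT tT; split; last first.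
  by apply: le_trans (speed s sT) _; rewrite lerDr addr_ge0.
have /andP[s0 s1] := sT; have /andP[t0 t1] := tT.
have [st|ts] := leP s t.
  apply: le_trans (taylor s t s0 st t1) _; rewrite ler_wpM2r ?sqr_ge0//.
  by apply: le_trans CE; rewrite lerDl.
have {}ts := ltW ts; have D0 : 0 <= s - t by rewrite subr_ge0.
have tay := taylor t s t0 ts s1.
have dst : `|x s - x t| <= (s - t) * (MT + L * MT * T).
  rewrite -(subrK ((s - t) *: F (x t)) (x s - x t)).
  apply: le_trans (ler_normD _ _) _; rewrite normrZ ger0_norm//.
  have : (s - t) * `|F (x t)| <= (s - t) * MT by rewrite ler_wpM2l// speed.
  have : L * MT * (s - t) * (s - t) <= L * MT * (s - t) * T.
    by rewrite ler_wpM2l ?mulr_ge0//; lra.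
  by lra.
rewrite (_ : x t - x s - _ =
   - (x s - x t - (s - t) *: F (x t)) + (s - t) *: (F (x s) - F (x t))); last first.
  rewrite -(opprB s t) scaleNr opprK scalerBr [RHS]addrC opprB addrA subrK opprB.
  by rewrite addrC.
apply: le_trans (ler_normD _ _) _; rewrite normrN normrZ ger0_norm//.
have : (s - t) * `|F (x s) - F (x t)| <= (s - t) * (L * ((s - t) * (MT + L * MT * T))).
  rewrite ler_wpM2l//; apply: le_trans (F_lip _ _) _; exact: ler_wpM2l.
have : (L * MT + L * (MT + L * MT * T)) * (t - s) ^+ 2 <= C * (t - s) ^+ 2.
  by rewrite ler_wpM2r ?sqr_ge0.
by lra.
Qed.

End Lipschitz_ode.

(** * Differential inequalities and uniqueness *)

Lemma dini_nonincreasing (R : realType) (w : R -> R) : continuous w ->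
  (forall t, 0 <= t -> forall e, 0 < e -> exists2 d, 0 < d &
    forall h, 0 < h -> h < d -> w (t + h) <= w t + e * h) ->
  forall t, 0 <= t -> w t <= w 0.
Proof.
move=> cw dini t t0.
have main e : 0 < e -> w t <= w 0 + e * t.
  (* By continuity the supremum of [S] lies in [S]; the slope [e] allows one more step beyond it
     unless it is [t]. *)
  move=> e0; pose S := [set s | 0 <= s <= t /\ w s <= w 0 + e * s].
  have S0 : S 0 by split; [rewrite lexx t0 | rewrite mulr0 addr0].
  have supS : has_sup S.
    by split; [exists 0 | exists t => s [/andP[]]].
  pose m := sup S.
  have ubm s : S s -> s <= m by move=> Ss; apply: ub_le_sup => //; case: supS.
  have m0 : 0 <= m := ubm 0 S0.
  have mt : m <= t by apply: ge_sup; [exists 0 | move=> s [/andP[]]].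
  have wm : w m <= w 0 + e * m.
    apply/ler_addgt0Pr => r r0.
    have /cvgrPdist_le /(_ _ r0) /nbhs_ballP[d /= d0 hd] := cw m.
    have [s Ss ms] := sup_adherent d0 supS; rewrite -/m in ms.
    have sm := ubm s Ss.
    have /hd : ball m d s.
      by rewrite /ball /= ger0_norm ?subr_ge0//; lra.
    rewrite ler_norml => /andP[_]; case: Ss => _ ws.
    have : e * s <= e * m by rewrite ler_pM2l.
    by move: ws => /= ws; lra.
  have [tm|mlt] := leP t m.
    by have -> : t = m by apply/eqP; rewrite eq_le tm.
  have [d d0 hd] := dini m m0 e e0.
  pose h := Num.min (d / 2) (t - m).
  have h0 : 0 < h by rewrite lt_min subr_gt0 mlt divr_gt0.
  have hd' : h < d by rewrite gt_min ltr_pdivrMr// ltr_pMr// ltr1n.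
  have hm : h <= t - m by rewrite ge_min lexx orbT.
  have : S (m + h).
    split; first by apply/andP; split; lra.
    by have := hd h h0 hd'; lra.
  by move/ubm; lra.
apply/ler_addgt0Pr => e e0.
have t1 : 0 < t + 1 by lra.
apply: le_trans (main (e / (t + 1)) _) _; first by rewrite divr_gt0.
by rewrite lerD2l mulrAC ler_pdivrMr// ler_pM2l// lerDl.
Qed.

(** Neither [u] nor [L] has a prescribed sign: uniqueness takes a distance for [u], the decay bound
    takes [u = - |G x|] with [L = - 1]. *)
Lemma dini_gronwall (R : realType) (u : R -> R) (L : R) : continuous u ->
  (forall t, 0 <= t -> forall e, 0 < e -> exists2 d, 0 < d &
    forall h, 0 < h -> h < d -> u (t + h) <= u t + h * (L * u t + e)) ->
  forall t, 0 <= t -> u t <= u 0 * expR (L * t).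
Proof.
move=> cu dini t t0; pose w s := u s * expR (- (L * s)).
suff : w t <= w 0.
  by rewrite /w mulr0 oppr0 expR0 mulr1 expRN ler_pdivrMr ?expR_gt0.
apply: dini_nonincreasing t0 => {t} [s|t t0 e e0].
  apply: cvgM; first exact: cu.
  apply: (@continuous_comp _ _ _ (fun s => - (L * s)) expR); last exact: continuous_expR.
  by apply: cvgN; apply: cvgM; [exact: cvg_cst | exact: cvg_id].
pose E := expR (- (L * t)); have E0 : 0 < E := expR_gt0 _.
pose c := `|u t| * L ^+ 2 + 1.
have c0 : 0 < c by rewrite ltr_wpDl// mulr_ge0// sqr_ge0.
have [|d d0 hd] := dini t t0 (e / (4 * E)); first by rewrite divr_gt0// mulr_gt0.
(* [d1] ensures [|L * h| <= 1/2], and [d2] keeps the second-order error below [e / 2 * h]. The slack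
   [e / (4 * E)] costs the other half, because [q <= 2]. *)
pose d1 := (2 * (`|L| + 1))^-1; pose d2 := e / (2 * E * c).
have d10 : 0 < d1 by rewrite invr_gt0 mulr_gt0// ltr_wpDl.
have d20 : 0 < d2 by rewrite divr_gt0// !mulr_gt0.
exists (Num.min d (Num.min d1 d2)) => [|h h0]; first by rewrite !lt_min d0 d10.
rewrite !lt_min => /and3P[hd0 hd1 hd2].
have z2 : `|L * h| <= 2^-1.
  rewrite normrM (ger0_norm (ltW h0)).
  have : h * (2 * (`|L| + 1)) < 1 by rewrite -ltr_pdivlMr ?div1r// mulr_gt0// ltr_wpDl.
  by have := normr_ge0 L; lra.
set z := L * h in z2.
have {z2}/andP[zl zu] : - 2^-1 <= z <= 2^-1 by rewrite -ler_norml.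
pose q := expR (- z); have q0 : 0 < q := expR_gt0 _.
(* The enclosure [1 - z ^+ 2 <= (1 + z) * q <= 1] handles both signs of [u t]: the upper bound when
   [u t >= 0], the lower one otherwise. *)
have q1 : (1 + z) * q <= 1.
  by rewrite /q expRN ler_pdivrMr ?expR_gt0// mul1r expR_ge1Dx.
have q2 : 1 - z <= q by exact: expR_ge1Dx.
have q3 : 1 - z ^+ 2 <= (1 + z) * q.
  have : (1 + z) * (1 - z) <= (1 + z) * q by rewrite ler_wpM2l//; lra.
  by lra.
have q4 : q <= 2.
  have : 2^-1 * q <= (1 + z) * q by rewrite ler_pM2r//; lra.
  by lra.
have -> : w (t + h) = u (t + h) * (E * q).
  by rewrite /w /E /q -expRD mulrDr opprD.
have Eq0 : 0 < E * q by rewrite mulr_gt0.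
have s1 := hd h h0 hd0; rewrite -(ler_pM2r Eq0) in s1.
apply: le_trans s1 _; rewrite /w -/E.
have s2 : u t * ((1 + z) * q) <= u t + `|u t| * z ^+ 2.
  have [ut|ut] := leP 0 (u t).
    have : u t * ((1 + z) * q) <= u t * 1 by rewrite ler_wpM2l.
    have : 0 <= u t * z ^+ 2 by rewrite mulr_ge0// sqr_ge0.
    by rewrite (ger0_norm ut); lra.
  have : (- u t) * (1 - z ^+ 2) <= (- u t) * ((1 + z) * q).
    by rewrite ler_wpM2l//; lra.
  by rewrite (ltr0_norm ut); lra.
have s3 : E * (u t * ((1 + z) * q)) <= E * (u t + `|u t| * z ^+ 2).
  by rewrite ler_pM2l.
have s4 : (E * (e / (4 * E)) * h) * q <= (E * (e / (4 * E)) * h) * 2.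
  by rewrite ler_wpM2l// !mulr_ge0 ?invr_ge0 ?mulr_ge0 ?ltW.
have E4 : E * (e / (4 * E)) = e / 4 by field; rewrite gt_eqF.
rewrite E4 in s4.
have s5 : h * (2 * E * c) <= e by rewrite -ler_pdivlMr ?ltW// !mulr_gt0.
have s6 : E * (`|u t| * z ^+ 2) <= e / 2 * h.
  have -> : E * (`|u t| * z ^+ 2) = h * (h * (E * (`|u t| * L ^+ 2))) by rewrite /z; ring.
  rewrite [e / 2 * h]mulrC ler_pM2l//.
  have : h * (E * (`|u t| * L ^+ 2)) <= h * (E * c).
    by rewrite !ler_pM2l// lerDl.
  by lra.
have -> : (u t + h * (L * u t + e / (4 * E))) * (E * q) =
   E * (u t * ((1 + z) * q)) + E * (e / (4 * E)) * h * q by rewrite /z; ring.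
rewrite E4; lra.
Qed.

Lemma has_deriv_nonnegP (R : realType) (V : normedModType R) (x x' : R -> V) :
  has_deriv_nonneg x x' <->
  forall t, 0 <= t -> forall e, 0 < e -> exists2 d, 0 < d &
    forall h, `|h| < d -> 0 <= t + h -> `|x (t + h) - x t - h *: x' t| <= e * `|h|.
Proof.
have scale t h : h != 0 ->
    `|x (t + h) - x t - h *: x' t| = `|h| * `|x' t - h^-1 *: (x (t + h) - x t)|.
  by move=> h0; rewrite -normrZ scalerBr scalerA divff// scale1r distrC.
split=> hx t t0.
  move=> e e0; have /cvgrPdist_le /(_ _ e0) /nbhs_ballP[d /= d0 hd] := hx t t0.
  exists d => // h hh th; have [->|h0] := eqVneq h 0.
    by rewrite addr0 subrr scale0r subr0 !normr0 mulr0.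
  rewrite scale// mulrC ler_wpM2r//; apply: hd => //=.
  by rewrite /ball /= sub0r normrN.
apply/cvgrPdist_le => e e0; apply/nbhs_ballP.
have [d d0 hd] := hx t t0 e e0; exists d => //= h.
rewrite /ball /= sub0r normrN => hh [h0 th].
by have := hd h hh th; rewrite scale// mulrC ler_pM2r ?normr_gt0.
Qed.

(** Clamping time at [0] produces functions continuous on all of [R], as the Gronwall lemma
    requires. *)
Lemma has_deriv_nonneg_continuous (R : realType) (V : normedModType R)
    (x x' : R -> V) : has_deriv_nonneg x x' -> continuous (fun t : R => x (Num.max t 0)).
Proof.
move=> /has_deriv_nonnegP hx t; set t1 := Num.max t 0.
have t10 : 0 <= t1 by rewrite le_max lexx orbT.
have [d d0 hd] := hx t1 t10 1 ltr01.
pose c := `|x' t1| + 1; have c0 : 0 < c by rewrite ltr_wpDl.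
apply/cvgrPdist_le => e e0; apply/nbhs_ballP.
exists (Num.min d (e / c)) => [|s] /=; first by rewrite lt_min d0 divr_gt0.
rewrite /ball /= lt_min => /andP[sd se].
rewrite -/t1; set s1 := Num.max s 0.
have s10 : 0 <= s1 by rewrite le_max lexx orbT.
have ss : `|s1 - t1| <= `|t - s|.
  rewrite /s1 /t1 distrC [`|t - s|]distrC.
  by have [] := leP s 0; have [] := leP t 0; move=> ? ?; rewrite ?subrr ?normr0//;
    rewrite ler_norml; apply/andP; split; have := ler_norm (s - t);
    have := ler_norm (- (s - t)); rewrite ?normrN; lra.
have := hd (s1 - t1) (le_lt_trans ss sd); rewrite addrC subrK => /(_ s10) h.
rewrite distrC -(subrK ((s1 - t1) *: x' t1) (x s1 - x t1)).
apply: le_trans (ler_normD _ _) _; rewrite normrZ.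
apply: (@le_trans _ _ (`|s1 - t1| * c)); first by rewrite /c; lra.
by rewrite -ler_pdivlMr//; apply: le_trans ss (ltW se).
Qed.

(** Meant for [1 / |G x|], which the decay estimate bounds on each [[0, T]]. *)
Lemma exprn_lip (R : realType) (B : R) n : 0 <= B -> exists2 K, 0 <= K &
  forall a b : R, 0 <= a <= B -> 0 <= b <= B -> `|a ^+ n - b ^+ n| <= K * `|a - b|.
Proof.
move=> B0; elim: n => [|n [K K0 IH]].
  by exists 0 => // a b _ _; rewrite !expr0 subrr normr0 mul0r.
exists (B * K + B ^+ n); first by rewrite addr_ge0 ?mulr_ge0 ?exprn_ge0.
move=> a b aB bB; rewrite !exprS.
have -> : a * a ^+ n - b * b ^+ n = a * (a ^+ n - b ^+ n) + b ^+ n * (a - b) by ring.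
apply: le_trans (ler_normD _ _) _; rewrite !normrM mulrDl.
have /andP[a0 a1] := aB; have /andP[b0 b1] := bB.
apply: lerD.
  by rewrite -mulrA ler_pM// ?IH// ger0_norm.
by rewrite ler_wpM2r// ger0_norm ?exprn_ge0// lerXn2r.
Qed.

Section Solutions.
Context {R : realType} {V : normedModType R} (F : V -> V) (L : R).
Hypothesis F_lip : forall x y, `|F x - F y| <= L * `|x - y|.

Lemma lipschitz_continuous : continuous F.
Proof.
move=> y; apply/cvgrPdist_le => e e0; apply/nbhs_ballP.
have c0 : 0 < `|L| + 1 by rewrite ltr_wpDl.
exists (e / (`|L| + 1)) => [|z]; first by rewrite /= divr_gt0.
rewrite -ball_normE /ball_ /= => yz; apply: le_trans (F_lip _ _) _.
have : `|y - z| * (`|L| + 1) <= e by rewrite -ler_pdivlMr// ltW.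
have : L * `|y - z| <= `|L| * `|y - z| by rewrite ler_wpM2r// ler_norm.
by have := normr_ge0 (y - z); lra.
Qed.

Lemma lipschitz_ode_unique (x y x' y' : R -> V) :
  has_deriv_nonneg x x' -> has_deriv_nonneg y y' ->
  (forall t, 0 <= t -> x' t = F (x t)) -> (forall t, 0 <= t -> y' t = F (y t)) ->
  x 0 = y 0 -> forall t, 0 <= t -> y t = x t.
Proof.
move=> dx dy xF yF xy0 t t0.
pose u (s : R) := `|y (Num.max s 0) - x (Num.max s 0)|.
have uE s : 0 <= s -> u s = `|y s - x s| by move=> s0; rewrite /u max_l.
apply/eqP; rewrite -subr_eq0 -normr_le0 -uE//.
have <- : u 0 * expR (L * t) = 0 by rewrite uE// xy0 subrr normr0 mul0r.
apply: dini_gronwall t0 => {t} [t|t t0 e e0].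
  apply: cvg_norm; apply: cvgB; [exact: has_deriv_nonneg_continuous dy t|exact: has_deriv_nonneg_continuous dx t].
move/has_deriv_nonnegP in dx; move/has_deriv_nonnegP in dy.
have e20 : 0 < e / 2 by rewrite divr_gt0.
have [d1 d10 h1] := dx t t0 _ e20; have [d2 d20 h2] := dy t t0 _ e20.
exists (Num.min d1 d2) => [|h h0]; first by rewrite lt_min d10.
rewrite lt_min => /andP[hd1 hd2].
have th : 0 <= t + h by rewrite addr_ge0// ltW.
have hE : `|h| = h by rewrite gtr0_norm.
have := h1 h; have := h2 h; rewrite hE xF// yF// => /(_ hd2 th) {}h2 /(_ hd1 th) {}h1.
rewrite !uE//.
set p := y (t + h) - _ - _ in h2; set q := x (t + h) - _ - _ in h1.
have -> : y (t + h) = p + h *: F (y t) + y t by rewrite /p !subrK.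
have -> : x (t + h) = q + h *: F (x t) + x t by rewrite /q !subrK.
rewrite opprD addrACA opprD [_ + (- q - _)]addrACA -scalerBr.
apply: le_trans (ler_normD _ _) _; apply: le_trans (lerD (ler_normD _ _) (lexx _)) _.
apply: le_trans (lerD (lerD (ler_normB _ _) (lexx _)) (lexx _)) _.
rewrite normrZ hE.
have : h * `|F (y t) - F (x t)| <= h * (L * `|y t - x t|) by rewrite ler_pM2l.
by lra.
Qed.

End Solutions.

(** * The closed-loop system *)

Theorem theorem2p2 (R : realType) (H : completeNormedModType R)
    (ip : H -> H -> R) (A : H -> set H) (theta : R) (p : nat) (x0 : H) :
  is_inner_product ip ->
  maximal_monotone ip A ->
  (exists z, A z 0) ->
  0 < theta ->
  (1 <= p)%N ->
  ~ A x0 0 ->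
  exists (x : R -> H) (lam : R -> R),
    [/\ is_solution A theta p x0 x lam,
        C1_nonneg x,
        loc_lipschitz_nonneg lam,
        (forall (y : R -> H) (mu : R -> R),
           is_solution A theta p x0 y mu -> C1_nonneg y -> loc_lipschitz_nonneg mu ->
           forall t, 0 <= t -> y t = x t /\ mu t = lam t)
      & ((2 <= p)%N -> forall t, 0 <= t ->
           `|x t - resolvent A (lam t) (x t)|
             >= `|x 0 - resolvent A (lam 0) (x 0)| * expR (- t))].
Proof.
move=> ipP Amax Azero theta0 p1 nA.
set n := (p - 1)%N.
pose G := feedback_residual A theta n; pose F z := - G z.
have F_lip y z : `|F y - F z| <= n.+1%:R * `|y - z|.
  rewrite /F -opprD normrN; exact: (feedback_residual_lip _ ipP Amax Azero theta0).
have [x [x00 xT]] := lipschitz_ode (ler0n R n.+1) F_lip x0.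
have dx : has_deriv_nonneg x (F \o x).
  apply/has_deriv_nonnegP => t t0 e e0.
  (* The horizon [t + 1] leaves room for increments of size below [1] on both sides of [t]. *)
  have T0 : 0 <= t + 1 by rewrite addr_ge0.
  have [C C0 hC] := xT (t + 1) T0.
  have C1 : 0 < C + 1 by rewrite ltr_wpDl.
  exists (Num.min 1 (e / (C + 1))) => [|h]; first by rewrite lt_min ltr01 divr_gt0.
  rewrite lt_min => /andP[h1 he] th.
  have [||h2 _] := hC t (t + h); rewrite ?t0 ?th ?lerD2l/=.
  - by rewrite lerDl.
  - by rewrite (le_trans (ler_norm h))// ltW.
  have E : t + h - t = h by rewrite addrC addKr.
  rewrite E in h2; apply: le_trans h2 _.
  rewrite -[h ^+ 2]ger0_norm ?sqr_ge0// normrX expr2 mulrA ler_wpM2r//.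
  rewrite ltr_pdivlMr// in he.
  by have := normr_ge0 h; lra.
have cX := has_deriv_nonneg_continuous dx.
have cG y z : `|G z| <= `|G y| + `|y - z|.
  exact: (feedback_residual_norm_lip _ ipP Amax Azero theta0).
(* The minus sign turns a lower bound into a Gronwall upper bound. The rate is [- 1] for every [p],
   as [|G|] is 1-Lipschitz and the speed equals [|G x|]. *)
have nonvanishing t : 0 <= t -> `|G x0| * expR (- t) <= `|G (x t)|.
  move=> t0; pose u (s : R) := - `|F (x (Num.max s 0))|.
  have uE s : 0 <= s -> u s = - `|G (x s)| by move=> s0; rewrite /u max_l// normrN.
  have cu : continuous u.
    move=> s; apply: cvgN; apply: cvg_norm.
    apply: (@continuous_comp _ _ _ (fun s : R => x (Num.max s 0)) F); first exact: cX.
    exact: (lipschitz_continuous F_lip).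
  have := @dini_gronwall R u (- 1) cu _ t t0.
  rewrite !uE// x00 mulN1r mulNr lerN2; apply.
  move=> s s0 e e0; have /has_deriv_nonnegP /(_ s s0 e e0)[d d0 hd] := dx.
  exists d => // h h0 hh.
  have sh : 0 <= s + h by rewrite addr_ge0// ltW.
  have := hd h; rewrite gtr0_norm// => /(_ hh sh) {}hd.
  rewrite !uE//.
  have := cG (x (s + h)) (x s).
  have : `|x (s + h) - x s| <= e * h + h * `|G (x s)|.
    rewrite -(subrK (h *: F (x s)) (x (s + h) - x s)).
    apply: le_trans (ler_normD _ _) _; rewrite lerD//.
    by rewrite normrZ gtr0_norm// /F normrN.
  by lra.
have Gx0 : 0 < `|G x0|.
  exact: (feedback_residual_gt0 _ _ ipP Amax Azero).
have Gxt t : 0 <= t -> 0 < `|G (x t)|.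
  by move=> t0; apply: lt_le_trans (nonvanishing t t0); rewrite mulr_gt0 ?expR_gt0.
have nAx t : 0 <= t -> ~ A (x t) 0.
  move=> t0; exact: (feedback_residual_memN ipP Amax Azero (Gxt t t0)).
pose lam t := feedback_index A theta n (x t).
have lam0 t : 0 < lam t by exact: feedback_index_gt0.
pose x' (t : R) := F (x (Num.max t 0)).
have dx' : has_deriv_nonneg x x'.
  apply/has_deriv_nonnegP => t t0; rewrite /x' max_l//.
  by move/has_deriv_nonnegP: dx; apply.
have cx' : {within `[0, +oo[, continuous x'}.
  apply: continuous_subspaceT => s.
  apply: (@continuous_comp _ _ _ (fun s : R => x (Num.max s 0)) F); first exact: cX.
  exact: (lipschitz_continuous F_lip).
exists x, lam; split.
- split => //.
  + move=> t t0; rewrite distrC.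
    exact: (feedback_indexE n ipP Amax Azero theta0 (nAx t t0)).
  + exists x'; split=> // t t0.
    by rewrite /x' max_l// -addrA /F addNr.
- by exists x'.
- move=> T T0; have [C C0 hC] := xT T T0.
  pose c := `|G x0| * expR (- T).
  have c0 : 0 < c by rewrite mulr_gt0 ?expR_gt0.
  have cG' t : 0 <= t <= T -> c <= `|G (x t)|.
    move=> /andP[t0 tT]; apply: le_trans (nonvanishing t t0).
    by rewrite ler_pM2l// ler_expR lerN2.
  have ci : 0 <= c^-1 by rewrite invr_ge0 ltW.
  have [K K0 hK] := exprn_lip n ci.
  (* [K] bounds the power, each [c^-1] an inverse of [|G|], and [C * T + C] the increment of [x]
     through its Taylor estimate. *)
  exists (theta * (K * (c^-1 * c^-1 * (C * T + C)))) => s t sT tT.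
  have /andP[s0 s1] := sT; have /andP[t0 t1] := tT.
  rewrite /lam (feedback_index_eq n ipP Amax Azero theta0 (nAx s s0)).
  rewrite (feedback_index_eq n ipP Amax Azero theta0 (nAx t t0)).
  rewrite -!exprVn -mulrBr normrM (gtr0_norm theta0) -!mulrA ler_pM2l//.
  have inv t' : 0 <= t' <= T -> 0 <= `|G (x t')|^-1 <= c^-1.
    move=> h; rewrite invr_ge0 normr_ge0/= lef_pV2 ?posrE ?cG'//.
    by case/andP: h => /Gxt.
  apply: le_trans (hK _ _ (inv s sT) (inv t tT)) _; rewrite ler_wpM2l//.
  have /andP[is0 is1] := inv s sT; have /andP[it0 it1] := inv t tT.
  have -> : `|G (x s)|^-1 - `|G (x t)|^-1 =
      `|G (x s)|^-1 * (`|G (x t)|^-1 * (`|G (x t)| - `|G (x s)|)).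
    by field; rewrite !gt_eqF ?Gxt.
  rewrite !normrM (ger0_norm is0) (ger0_norm it0).
  rewrite ler_pM ?mulr_ge0//; rewrite ler_pM//.
  have [xts Fx] := hC t s tT sT.
  have dist : `|x t - x s| <= (C * T + C) * `|s - t|.
    rewrite distrC -(subrK ((s - t) *: F (x t)) (x s - x t)).
    apply: le_trans (ler_normD _ _) _; rewrite mulrDl lerD//.
      apply: le_trans xts _; rewrite -[_ ^+ 2]ger0_norm ?sqr_ge0//.
      rewrite normrX expr2 mulrA ler_wpM2r// ler_wpM2l//.
      by rewrite ler_norml; apply/andP; split; lra.
    by rewrite normrZ mulrC ler_wpM2r.
  apply: le_trans dist; rewrite ler_norml.
  have := cG (x t) (x s); have := cG (x s) (x t); rewrite (distrC (x s) (x t)).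
  by move=> h1 h2; apply/andP; split; lra.
- move=> y mu [y0 mu0 muE [y' [dy _ yE]]] _ _.
  have yG t : 0 <= t -> y' t = F (y t).
    move=> t0; have /eqP := yE t t0.
    rewrite -addrA addr_eq0 => /eqP ->; rewrite /F; congr (- _).
    rewrite -/(residual A (mu t) (y t)).
    (* A competing solution is not yet known to avoid the zeros of [A], and for [p = 1] its index
       equation does not exclude them. There both residuals vanish, whatever the index. *)
    have [Ay|nAy] := pselect (A (y t) 0).
      rewrite (residual_zero ipP Amax Azero (mu0 t t0) Ay).
      by rewrite /G (feedback_residual0 theta n ipP Amax Azero Ay).
    rewrite /G /feedback_residual; congr (residual A _ _).
    apply: (feedback_index_unique ipP Amax Azero theta0 nAy (mu0 t t0)).
    by rewrite /residual distrC; exact: muE.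
  move=> t t0.
  have yx : y t = x t.
    apply: (lipschitz_ode_unique F_lip dx dy) => //; by rewrite x00 y0.
  split=> //.
  rewrite /lam; apply: (feedback_index_unique ipP Amax Azero theta0 (nAx t t0) (mu0 t t0)).
  by rewrite /residual distrC -yx; exact: muE.
- by move=> _ t t0; have := nonvanishing t t0; rewrite -x00.
Qed.
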